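(* Let $a$, $p$ and $m$ be positive integers with $a\ge2$ and $1\le m\le p$. The partition complex $\mathcal{P}(a,p,m)$ is PR with degree type $$(\overbrace{1,\dots,1,\underbrace{a,1,\dots,1}_{m}}^{p}),$$ that is, with degree type $(d_p,\dots,d_1)$ where $d_m=a$ and $d_i=1$ for all $i\neq m$.
   Context: Partition complexes: for integers $a\ge2$, $p\ge-1$, let $V_p^a=X_p\sqcup Y_p^a$, where $X_p=\{x_i:0\le i\le p\}$ and $Y_p^a=\{y_i^j:0\le i\le p,\ 1\le j\le a-1\}$. The group $S_p^0=\mathrm{Sym}\{0,\dots,p\}$ acts on $V_p^a$ by $g(x_i)=x_{g(i)}$, $g(y_i^j)=y_{g(i)}^j$. For $1\le i\le p+1$ let $\mathbb{P}(a,i)$ be the set of partitions $\lambda=(\lambda_1\ge\dots\ge\lambda_i>0)$ of $a+i-2$ into exactly $i$ parts, and for $\lambda\in\mathbb{P}(a,i)$ put $$G_{p,i}^\lambda=\{x_i,\dots,x_p\}\sqcup\{y_r^j:0\le r\le i-1,\ 1\le j\le\lambda_{r+1}\}.$$ For $1\le m\le p+1$, $\mathcal{P}(a,p,m)$ is the simplicial complex on $V_p^a$ generated by (i.e. consisting of all subsets of) the sets $gG_{p,i}^\lambda$ with $g\in S_p^0$, $1\le i\le m$, $\lambda\in\mathbb{P}(a,i)$. PR complexes: fix an arbitrary field $\mathbb{K}$. Simplicial complexes are finite and contain $\emptyset$; $\widetilde H_i(\Delta)$ denotes reduced simplicial homology with coefficients in $\mathbb{K}$, with $\widetilde H_{-1}(\{\emptyset\})=\mathbb{K}$.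 For $\sigma\in\Delta$, $\mathrm{link}_\Delta\sigma=\{\tau\in\Delta:\tau\cap\sigma=\emptyset,\ \tau\cup\sigma\in\Delta\}$. $\Delta$ is PR (over $\mathbb{K}$) if for every $i$ and all $\sigma,\tau\in\Delta$, $\widetilde H_i(\mathrm{link}_\Delta\sigma)\neq0\neq\widetilde H_i(\mathrm{link}_\Delta\tau)$ implies $|\sigma|=|\tau|$. Degree type: for a PR complex $\Delta$, let $p$ be the maximum index for which some face $\sigma$ has $\widetilde H_{p-1}(\mathrm{link}_\Delta\sigma)\neq0$; for $0\le i\le p$ let $s_i$ be the common size $|\sigma|$ of the faces $\sigma$ with $\widetilde H_{i-1}(\mathrm{link}_\Delta\sigma)\neq 0$ (such faces exist for each such $i$); for $1\le i\le p$ let $d_i=s_{i-1}-s_i$. The degree type of $\Delta$ is $(d_p,\dots,d_1)$. *)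

(* Defs.v *)
From HB Require Import structures.
From mathcomp Require Import all_boot all_order perm all_algebra.

Set Implicit Arguments.
Unset Strict Implicit.
Unset Printing Implicit Defensive.

Import GRing.Theory.
Local Open Scope ring_scope.

Section Complexes.

Variable V : finType.
Implicit Types (D : {set {set V}}) (s t : {set V}).

(* Elements of V are not required to be vertices of D. *)
Definition simplicial_complex D : Prop :=
  set0 \in D /\ (forall s t, t \subset s -> s \in D -> t \in D).

Definition link D s : {set {set V}} :=
  [set t in D | [disjoint t & s] && (t :|: s \in D)].

End Complexes.

Section Homology.

Variables (K : fieldType) (V : finType).
Implicit Types (D : {set {set V}}) (s t : {set V}) (i : int).

(* Chains in all degrees at once: a chain is a K-valued function on the
   subsets of V, and the faces of a given dimension cut out a subspace. *)
Local Notation chain := {ffun {set V} -> K^o}.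

Definition face_chain s : chain := [ffun t : {set V} => (t == s)%:R].

Definition chains D i : {vspace chain} :=
  span [seq face_chain s | s in [set s in D | #|s|%:Z == i + 1]].

(* Vertices are ordered by enum_rank: the sign of s :\ v in the boundary of s
   is given by the position of v in s. *)
Definition bsign (v : V) s : K :=
  (-1) ^+ #|[set w in s | (enum_rank w < enum_rank v)%N]|.

(* The coefficient of t collects the sets s = v |: t of which t is a facet.
   As t may be empty, this is the boundary of the augmented complex. *)
Definition boundary_fun (c : chain) : chain :=
  [ffun t : {set V} => \sum_(v | v \notin t) bsign v (v |: t) * (c (v |: t) : K)].

Lemma boundary_fun_is_linear : linear boundary_fun.
Proof.
move=> k c1 c2; apply/ffunP=> t; rewrite !ffunE scaler_sumr -big_split /=.
by apply: eq_bigr => v _; rewrite !ffunE mulrDr; congr (_ + _); exact: mulrCA.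
Qed.

HB.instance Definition _ :=
  GRing.isLinear.Build K chain chain _ boundary_fun boundary_fun_is_linear.

Definition boundary : 'End(chain) := linfun boundary_fun.

Definition cycles D i : {vspace chain} := (chains D i :&: lker boundary)%VS.
Definition boundaries D i : {vspace chain} := (boundary @: chains D (i + 1)%R)%VS.

(* The quotient of cycles by boundaries, realised as a complement of the
   subspace of boundaries inside the space of cycles. *)
Definition rhomology D i : {vspace chain} :=
  (cycles D i :\: boundaries D i)%VS.

Definition PR D : Prop :=
  simplicial_complex D /\
  forall i s t, s \in D -> t \in D ->
    rhomology (link D s) i != 0%VS -> rhomology (link D t) i != 0%VS ->
    #|s| = #|t|.

Definition has_link_homology D i : Prop :=
  exists2 s, s \in D & rhomology (link D s) i != 0%VS.

(* d lists (d_p, ..., d_1) in this order, with d_q = sz (q - 1) - sz q. *)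
Definition degree_type D (d : seq int) : Prop :=
  exists (p : nat) (sz : nat -> nat),
  [/\ has_link_homology D (p%:Z - 1)
        /\ (forall q : nat, has_link_homology D (q%:Z - 1) -> (q <= p)%N),
      forall q : nat, (q <= p)%N ->
        has_link_homology D (q%:Z - 1)
        /\ (forall s, s \in D -> rhomology (link D s) (q%:Z - 1) != 0%VS ->
              #|s| = sz q)
    & d = rev [seq (sz q.-1)%:Z - (sz q)%:Z | q <- iota 1 p]].

End Homology.

Section PartitionComplex.

Variables a p : nat.

(* inl i is x_i, and inr (i, j) is y_i^(j+1). *)
Definition vertex : finType := ('I_p.+1 + 'I_p.+1 * 'I_a.-1)%type.

Definition vertex_act (g : 'S_p.+1) (v : vertex) : vertex :=
  match v with
  | inl i => inl (g i)
  | inr (i, j) => inr (g i, j)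
  end.

(* Parts are 0-indexed: nth 0 l r is the part l_(r+1). *)
Definition is_partition (n : nat) (l : seq nat) : bool :=
  [&& sorted geq l, all (fun k => 0 < k)%N l & sumn l == n].

Definition Gset (i : nat) (l : seq nat) : {set vertex} :=
  [set v : vertex | match v with
                    | inl k => (i <= k)%N
                    | inr (r, j) => (r < i)%N && (j.+1 <= nth 0%N l r)%N
                    end].

(* The parts of a partition of n are at most n, so the partitions of a + i - 2
   into i parts are found among the i-tuples over 'I_(a + i - 2).+1. *)
Definition partition_complex (m : nat) : {set {set vertex}} :=
  [set s : {set vertex} | [exists g : 'S_p.+1, exists i : 'I_m.+1,
            exists l : i.-tuple 'I_(a + i - 2).+1,
    [&& (0 < i)%N,
        is_partition (a + i - 2) (map val l)
      & s \subset vertex_act g @: Gset i (map val l)]]].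

End PartitionComplex.

(* Main.v *)
(* A discrete Morse matching argument. Group the faces of a complex by a monotone
   key and toggle inside each group a vertex determined by the key: faces that are
   matched this way contribute no homology, and one size n may be treated at a
   time. A set s is a face of the partition complex iff no x_t and y_t^j lie in it
   together, at most m columns contain a y, some x_t is missing, and the sum over
   the columns of (height - 1) is at most a - 2. For a face s of size |s|:
   - if s has a gap below the top of some column, its link is a cone;
   - if s has no y and at most m columns are free of x, toggling y_t^1 (t depending
     on the set of x's) shows that the link is acyclic;
   - if s has no y and more than m columns are free, toggling x_t (t depending on
     the set of nonempty columns) leaves the boundary of a simplex, whose homology
     is in degree n - 1 with |s| + n = p;
   - if s has a y, toggling the lowest free y of a column, or some x_t, leaves
     faces r for which s :|: r is a facet without gaps, so |s| + n = p + a - 1,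
     where moreover n < m. *)
Require Import Defs.
From mathcomp Require Import all_boot all_order perm all_algebra zify.

Set Implicit Arguments.
Unset Strict Implicit.
Unset Printing Implicit Defensive.

Import GRing.Theory.

(** * Chains, the boundary map, and reduction along a matching *)

Section Chains.

Local Open Scope ring_scope.

Variables (K : fieldType) (V : finType).
Implicit Types (D : {set {set V}}) (s t : {set V}) (i : int) (n : nat).

Local Notation chain := {ffun {set V} -> K^o}.
Implicit Types c w : chain.
Local Notation bd := (@boundary_fun K V).

(** Chains are graded by the number n of vertices rather than by dimension, so the empty face sits
    at n = 0 and no integers occur. *)
Definition supported D n c := forall s, c s != 0 -> (s \in D) && (#|s| == n).

Lemma mem_chains D i n c : i + 1 = n%:Z -> c \in chains K D i <-> supported D n c.
Proof.
rewrite /chains => ->; split=> [|sc].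
  set X := [seq _ | s in _] => cX s; rewrite (coord_span (X := in_tuple X) cX).
  rewrite sum_ffunE; apply: contraNT => nD; apply/eqP/big1 => k _.
  have /imageP[t] : X`_k \in X by rewrite mem_nth.
  rewrite inE eqz_nat => tD Xk; rewrite ffunE /= Xk !ffunE.
  by case: (eqVneq s t) => [st|_]; [rewrite st tD in nD | rewrite scaler0].
have -> : c = \sum_s (c s : K) *: face_chain K s.
  apply/ffunP => t; rewrite sum_ffunE (bigD1 t) //= big1 => [|s nst].
    by rewrite !ffunE eqxx addr0 /GRing.scale /= mulr1.
  by rewrite !ffunE eq_sym (negPf nst) scaler0.
apply: memv_suml => s _; have [->|/sc/andP[sD sn]] := eqVneq (c s) 0.
  by rewrite scale0r mem0v.
by apply/memvZ/memv_span/image_f; rewrite inE sD eqz_nat.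
Qed.

(** The complement of the boundaries in the cycles vanishes iff every cycle is a boundary, so
    homology can be handled through single chains from here on. *)
Lemma rhomology_neq0P D i :
  rhomology K D i != 0%VS <->
  exists2 n, i + 1 = n%:Z & exists c, [/\ supported D n c, bd c = 0 &
    forall u, supported D n.+1 u -> bd u != c].
Proof.
rewrite /rhomology diffv_eq0; split.
  case/subvPn => c; rewrite memv_cap memv_ker lfunE /= => /andP[cD /eqP bc] nb.
  case hi: (i + 1) => [n|n]; last first.
    (* A negative i + 1 is no cardinality: the spanning family is empty, so c is 0 and hence a
       boundary. *)
    move: cD; rewrite /chains hi; set A := [set s in D | _].
    have -> : A = set0 by apply/setP => s; rewrite !inE andbF.
    rewrite /image_mem enum_set0 span_nil memv0 => /eqP c0.
    by rewrite c0 mem0v in nb.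
  exists n => //; exists c; split=> // [|u /(@mem_chains D (i + 1) n.+1) uD].
    exact/(mem_chains D _ hi).
  apply: contraNneq nb => <-; rewrite -[bd u](lfunE bd); apply: memv_img.
  by apply: uD; rewrite hi -addn1 PoszD.
case=> n hi [c [cD bc nb]]; apply/subvPn; exists c.
  by rewrite memv_cap memv_ker lfunE /= bc eqxx andbT; apply/(mem_chains D c hi).
apply/negP => /memv_imgP[u uD cu]; have /negP : bd u != c.
  apply: nb; apply/(@mem_chains D (i + 1) n.+1) => //.
  by rewrite hi -addn1 PoszD.
by rewrite cu lfunE eqxx.
Qed.

Lemma bsignU1 v s : v \notin s ->
  bsign K v (v |: s) = (-1) ^+ #|[set w in s | (enum_rank w < enum_rank v)%N]|.
Proof.
move=> vs; congr (_ ^+ _); apply: eq_card => w; rewrite !inE.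
by case: eqVneq => [->|]; rewrite ?ltnn ?andbF.
Qed.

(** Inserting v moves u by one position exactly when v precedes u. *)
Lemma bsignU2 (u v : V) s : u != v -> u \notin s -> v \notin s ->
  bsign K u (u |: (v |: s)) =
  (-1) ^+ (enum_rank v < enum_rank u)%N * bsign K u (u |: s).
Proof.
move=> uv us vs; rewrite !bsignU1 ?inE ?negb_or ?uv // -exprD; congr (_ ^+ _).
case: ltnP => vu.
  rewrite (_ : [set w in v |: s | _] = v |: [set w in s | (enum_rank w < enum_rank u)%N]).
    by rewrite cardsU1 !inE (negPf vs).
  by apply/setP=> w; rewrite !inE; case: eqVneq => // ->; rewrite vu.
rewrite add0n.  apply: eq_card => w; rewrite !inE; case: eqVneq => // ->.
by rewrite ltnNge vu !andbF.
Qed.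

(** Exactly one of u and v precedes the other, so just one of the two orders of insertion picks up
    an extra sign. *)
Lemma bsign_antisym (u v : V) s : u != v -> u \notin s -> v \notin s ->
  bsign K v (v |: s) * bsign K u (u |: (v |: s)) =
  - (bsign K u (u |: s) * bsign K v (v |: (u |: s))).
Proof.
move=> uv us vs; rewrite !bsignU2 // 1?eq_sym //.
have : enum_rank u != enum_rank v :> nat by rewrite (inj_eq val_inj) (inj_eq enum_rank_inj).
by case: ltngtP => // _ _; rewrite !(expr0, expr1, mul1r, mulN1r) !(mulrN, mulNr) ?opprK mulrC.
Qed.

Lemma bsign_sqr v s : bsign K v s * bsign K v s = 1.
Proof. by rewrite -expr2 sqrr_sign. Qed.

Lemma boundary_sq c : bd (bd c) = 0.
Proof.
apply/ffunP => t; rewrite !ffunE.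
(* [g v u] is the term in which v, then u, is added to t; the pairs with u before v cancel those
   with v before u by [bsign_antisym]. *)
pose g (v u : V) := bsign K v (v |: t) * bsign K u (u |: (v |: t)) * (c (u |: (v |: t)) : K).
transitivity (\sum_v \sum_(u | [&& v \notin t, u \notin t & u != v]) g v u).
  rewrite [LHS]big_mkcond; apply: eq_bigr => v _; case: (boolP (v \in t)) => vt /=.
    by rewrite big_pred0.
  rewrite ffunE mulr_sumr; apply: eq_big => u.
    by rewrite !inE negb_or andbC.
  by move=> _; rewrite mulrA.
rewrite (eq_bigr (fun v => \sum_(u | [&& v \notin t, u \notin t &
    (enum_rank u < enum_rank v)%N]) g v u
  + \sum_(u | [&& v \notin t, u \notin t & (enum_rank v < enum_rank u)%N]) g v u)); last first.
  move=> v _; rewrite (bigID (fun u => (enum_rank u < enum_rank v)%N)) /=.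
  congr (_ + _); apply: eq_bigl => u; rewrite -!andbA; congr (_ && (_ && _));
    rewrite -(inj_eq enum_rank_inj) -val_eqE /=; by case: ltngtP.
rewrite big_split /= [X in _ + X](exchange_big_dep predT) //= -big_split big1 //= => v _.
apply/eqP; rewrite addr_eq0 -sumrN; apply/eqP/eq_big => u; first by rewrite andbCA.
case/and3P=> vt ut luv; have uv : u != v by apply: contraTneq luv => ->; rewrite ltnn.
by rewrite /g bsign_antisym // mulNr (setUCA [set u]).
Qed.

Lemma supportedW D n c s : supported D n c -> s \notin D -> c s = 0.
Proof. by move=> cD; apply: contraNeq => /cD/andP[]. Qed.

Lemma supported_bd D n c : (forall s t, t \subset s -> s \in D -> t \in D) ->
  supported D n.+1 c -> supported D n (bd c).
Proof.
move=> dD cD t; rewrite ffunE => nz.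
have [v vt nzv] : exists2 v, v \notin t & c (v |: t) != 0.
  apply/exists_inP; apply: contraNT nz => /exists_inPn nz.
  by apply/eqP/big1 => v vt; have /negbNE/eqP -> := nz v vt; rewrite mulr0.
have /andP[vD] := cD _ nzv; rewrite cardsU1 vt eqSS => ->; rewrite andbT.
exact: dD (subsetUr _ _) vD.
Qed.

Lemma supportedB D n c w :
  supported D n c -> supported D n w -> supported D n (c - w).
Proof.
move=> cD wD s; rewrite !ffunE; have [->|/cD //] := eqVneq (c s) 0.
by rewrite sub0r oppr_eq0 => /wD.
Qed.

Lemma bdB c w : bd (c - w) = bd c - bd w.
Proof. exact: linearB. Qed.

(* Subtract the boundary of the cone with apex v over the part of w outside D'. *)
Lemma toggle_reduction D D' v n w :
    (forall s t, t \subset s -> s \in D -> t \in D) ->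
    (forall s t, t \subset s -> s \in D' -> t \in D -> t \in D') ->
    (forall s, s \in D -> s \notin D' -> #|s| = n ->
       (v |: s \in D) /\ (s :\ v \notin D')) ->
    supported D n w -> (forall s, s \in D -> s \notin D' -> bd w s = 0) ->
  exists2 u, supported D n.+1 u & supported D' n (w - bd u).
Proof.
move=> dD dD' tog wD bw.
pose u : chain := [ffun t : {set V} => if (v \in t) && (t :\ v \notin D')
  then bsign K v t * (w (t :\ v) : K) else 0].
have uD : supported D n.+1 u.
  move=> t; rewrite ffunE; case: ifP => [/andP[vt tD']|]; last by rewrite eqxx.
  rewrite mulf_eq0 negb_or => /andP[_ /wD/andP[tD /eqP tn]].
  have [] := tog _ tD tD' tn; rewrite setD1K // => -> _.
  by rewrite (cardsD1 v t) vt tn add1n eqxx.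
exists u => //; set w' := w - bd u.
have w'D : supported D n w' by apply: supportedB => //; apply: supported_bd.
(* At a face without v only the term x = v of the boundary of u survives, as u lives on sets
   containing v; it equals [w s]. *)
have w'0 s : s \in D -> s \notin D' -> v \notin s -> w' s = 0.
  move=> sD sD' vs; rewrite 2!ffunE [bd u s]ffunE (bigD1 v) //= big1 => [|x /andP[xs xv]].
    by rewrite ffunE setU11 setU1K // sD' mulrA bsign_sqr mul1r addr0 subrr.
  by rewrite ffunE !inE eq_sym (negPf xv) (negPf vs) mulr0.
move=> s nz; have /andP[sD /eqP sn] := w'D s nz; rewrite sn eqxx andbT.
apply: contraNT nz => sD'; have [vs|vs] := boolP (v \in s); last by rewrite w'0.
have [_ tD'] := tog s sD sD' sn.
have tD : s :\ v \in D by apply: dD sD; rewrite subsetDl.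
(* The boundary of w' still vanishes at s :\ v, and s is the only coface there on which w' can be
   nonzero: the others lack v, and those in D lie outside D'. *)
have := bw _ tD tD'; rewrite -[bd w]subr0 -(boundary_sq u) -bdB -/w' ffunE.
rewrite (bigD1 v) ?setD11 //= setD1K // big1 ?addr0 => [|x /andP[xt xv]].
  by move/eqP; rewrite mulf_eq0 signr_eq0.
have [xD|xD] := boolP (x |: s :\ v \in D); last by rewrite (supportedW w'D xD) mulr0.
rewrite w'0 ?mulr0 //.
  by apply: contra tD' => /dD'; apply=> //; rewrite subsetUr.
by rewrite !inE eqxx eq_sym (negPf xv).
Qed.

(* Remove from D the faces outside D0 with a key of maximal cardinality, and
   recurse. *)
Lemma matching_reduction (W : finType) (key : {set V} -> {set W})
    (pivot : {set W} -> V) D D0 n w :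
    (forall s t, t \subset s -> key t \subset key s) ->
    (forall s t, t \subset s -> s \in D -> t \in D) ->
    D0 \subset D ->
    (forall s t, t \subset s -> s \in D0 -> t \in D0) ->
    (forall s, s \in D -> s \notin D0 -> #|s| = n ->
      let v := pivot (key s) in
      [/\ v |: s \in D, s :\ v \notin D0,
          key (v |: s) = key s & key (s :\ v) = key s]) ->
    supported D n w -> (forall s, s \in D -> s \notin D0 -> bd w s = 0) ->
  exists2 u, supported D n.+1 u & supported D0 n (w - bd u).
Proof.
move=> mkey dD sD0 dD0; have [d] := ubnP #|D :\: D0|.
elim: d => // d IH in D dD sD0 w *; rewrite ltnS => leD tog wD bw.
have [DD0|[s0 s0D]] := set_0Vmem (D :\: D0).
  have {}DD0 : D = D0 by apply/eqP; rewrite eqEsubset sD0 andbT -setD_eq0 DD0.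
  exists 0; first by move=> s; rewrite ffunE eqxx.
  by rewrite (raddf0 bd) subr0 -DD0.
case: (@arg_maxnP _ s0 (mem (D :\: D0)) (fun s => #|key s|) s0D) => s1.
move=> /setDP[s1D s1D0] maxs1.
pose D1 := D :\: [set s in D :\: D0 | key s == key s1].
have notD1 s : s \in D -> s \notin D1 -> s \notin D0 /\ key s = key s1.
  by move=> sD; rewrite !inE sD !andbT negbK => /andP[? /eqP].
have D1D s : s \in D1 -> s \in D by rewrite inE => /andP[].
(* If a face t of s is in the removed group, its key lies in that of s and has maximal cardinality;
   so the keys agree and s would be removed too. *)
have dD1 s t : t \subset s -> s \in D1 -> t \in D -> t \in D1.
  move=> ts sD1 tD; have sD := D1D s sD1.
  apply: contraTT sD1 => /notD1[] // tD0 kt.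
  have sND0 : s \notin D0 by apply: contra tD0; apply: dD0.
  rewrite !inE sD sND0 /= !andbT negbK eq_sym -kt eqEcard mkey //= kt.
  by apply: maxs1; apply/setDP.
have [u1 u1D u1D1] : exists2 u, supported D n.+1 u & supported D1 n (w - bd u).
  apply: (@toggle_reduction D D1 (pivot (key s1))) => // [s sD sD1 sn|s sD sD1].
    have [sD0' ks] := notD1 s sD sD1; have := tog s sD sD0' sn; rewrite ks /= => -[vD vD0 _ kv].
    split=> //; rewrite in_setD [_ \in [set _ in _ | _]]inE in_setD vD0 kv eqxx (dD _ _ _ sD) //.
    by rewrite subsetDl.
  by have [sD0' _] := notD1 s sD sD1; apply: bw.
have D1w s : s \in D1 -> s \notin D0 -> bd (w - bd u1) s = 0.
  by move=> sD1 sD0'; rewrite bdB boundary_sq subr0 bw // D1D.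
have D0' s : s \in D0 -> s \in D1.
  by move=> sD0'; rewrite !inE sD0' (subsetP sD0).
have togD1 s : s \in D1 -> s \notin D0 -> #|s| = n -> let v := pivot (key s) in
    [/\ v |: s \in D1, s :\ v \notin D0, key (v |: s) = key s & key (s :\ v) = key s].
  move=> sD1 sD0' sn /=; have sD := D1D s sD1.
  have [vD vD0 kv kv'] := tog s sD sD0' sn.
  split=> //; move: sD1; rewrite !in_setD ![_ \in [set _ in _ | _]]inE !inE vD sD.
  by rewrite sD0' kv; case: (key s == _); rewrite ?andbF.
have leD1 : (#|D1 :\: D0| < d)%N.
  apply: leq_trans leD; apply: proper_card; apply/properP; split.
    by apply/setSD/subsetP.
  by exists s1; rewrite !inE s1D0 s1D ?eqxx.
have dD1' : forall s t, t \subset s -> s \in D1 -> t \in D1.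
  by move=> s t ts sD1; apply: (dD1 s) => //; apply: dD ts (D1D s sD1).
have [u2 u2D u2D0] := IH D1 dD1' (introT subsetP D0') _ leD1 togD1 u1D1 D1w.
exists (u1 + u2); last by rewrite (raddfD bd) opprD addrA.
rewrite -[u2]opprK; apply: supportedB => // s.
by rewrite ffunE oppr_eq0 => /u2D/andP[/D1D-> ->].
Qed.

(** Taking D0 empty reduces every cycle of size n to 0 modulo boundaries; only the faces of this one
    size have to be matched. *)
Lemma matching_rhomology (W : finType) (key : {set V} -> {set W})
    (pivot : {set W} -> V) D i n :
    (forall s t, t \subset s -> key t \subset key s) ->
    (forall s t, t \subset s -> s \in D -> t \in D) ->
    (forall s, s \in D -> #|s| = n -> let v := pivot (key s) in
      [/\ v |: s \in D, key (v |: s) = key s & key (s :\ v) = key s]) ->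
  i + 1 = n%:Z -> rhomology K D i = 0%VS.
Proof.
move=> mkey dD tog hi; apply/eqP/negP => /negP/rhomology_neq0P[n' hi'].
move: hi'; rewrite hi => -[<-] [c [cD bc nb]].
have [||||u uD] := @matching_reduction W key pivot D set0 n c mkey dD _ _ _ cD.
- exact: sub0set.
- by move=> s t _; rewrite inE.
- by move=> s sD _ sn v; have [? ? ?] := tog s sD sn; split; rewrite ?inE.
- by move=> s _ _; rewrite bc ffunE.
move=> c0; have /negP[] := nb u uD; apply/eqP/esym/ffunP => s.
have := c0 s; rewrite !ffunE inE /=.
by rewrite subr_eq0; case: eqVneq => // _ /(_ isT).
Qed.

Lemma supported_face_chain s : supported [set t : {set V} | t \subset s] #|s| (face_chain K s).
Proof. by move=> t; rewrite ffunE inE; case: (eqVneq t s) => [->|]; rewrite ?subxx ?eqxx. Qed.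

Lemma supported_bd_face_chain s n : #|s| = n.+1 ->
  supported [set t : {set V} | t \subset s] n (bd (face_chain K s)).
Proof.
move=> sn; apply: supported_bd => [t t' tt'|]; first by rewrite !inE; apply: subset_trans.
by rewrite -sn; apply: supported_face_chain.
Qed.

(** For x in s, the coefficient at s :\ x is a sign, since no one-point extension of s :\ x other
    than s contributes. *)
Lemma bd_face_chain_neq0 s : s != set0 -> bd (face_chain K s) != 0.
Proof.
case/set0Pn => x xs; apply/eqP => /ffunP/(_ (s :\ x)); rewrite !ffunE.
rewrite (bigD1 x) ?setD11 //= ffunE setD1K // eqxx mulr1 big1 ?addr0 => [|v /andP[vs vx]].
  by move/eqP; rewrite signr_eq0.
rewrite ffunE; case: eqP => [/setP/(_ x)|]; last by rewrite mulr0.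
by rewrite !inE eqxx eq_sym (negPf vx) xs.
Qed.

(* The boundary of f bounds a chain u of D minus f, so that f - u is a cycle. *)
Lemma facet_rhomology (W : finType) (key : {set V} -> {set W})
    (pivot : {set W} -> V) D f i n :
    (forall s t, t \subset s -> key t \subset key s) ->
    (forall s t, t \subset s -> s \in D -> t \in D) ->
    f \in D -> #|f| = n -> (forall v, v |: f \in D -> v \in f) ->
    (forall s, s \in D -> s != f -> let v := pivot (key s) in
      [/\ v |: s \in D, v |: s != f, key (v |: s) = key s & key (s :\ v) = key s]) ->
  i + 1 = n%:Z -> rhomology K D i != 0%VS.
Proof.
move=> mkey dD fD fn facet tog hi.
suff [u uD bu] : exists2 u, supported (D :\ f) n u & bd u = bd (face_chain K f).
  apply/rhomology_neq0P; exists n => //; exists (face_chain K f - u).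
  have cf : (face_chain K f - u) f = 1.
    by rewrite !ffunE eqxx (supportedW uD) ?setD11 // subr0.
  split; [|by rewrite bdB bu subrr|].
    apply: supportedB => s => [|/uD/andP[]]; last by rewrite inE => /andP[_ ->].
    by rewrite ffunE; case: (eqVneq s f) => [->|]; rewrite ?fD ?fn ?eqxx.
  (* No face of D extends f, so boundaries have coefficient 0 at f, while the cycle has coefficient
     1 there. *)
  move=> u' u'D; apply: contraNneq (oner_neq0 K) => cu; rewrite -cf -cu ffunE.
  rewrite big1 // => v vf; rewrite (supportedW u'D) ?mulr0 //.
  by apply: contra vf; apply: facet.
(* For n = 0 the face f is empty and its boundary is already 0, so u = 0 serves. *)
case: n fn {hi} => [/eqP|n fn].
  rewrite cards_eq0 => /eqP f0; exists 0; first by move=> s; rewrite ffunE eqxx.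
  rewrite (raddf0 bd); apply/esym/ffunP => t; rewrite !ffunE big1 // => v _.
  by rewrite ffunE f0 -subset0 subUset sub1set inE mulr0.
have [||||||u uD u0] := @matching_reduction W key pivot (D :\ f) set0 n (bd (face_chain K f)) mkey.
- move=> s t ts; rewrite !inE => /andP[sf sD]; rewrite (dD s) // andbT.
  apply: contraNneq sf => tf; rewrite eq_sym eqEsubset -tf ts tf.
  by apply/subsetP => v vs; apply: facet; apply: dD sD; rewrite subUset sub1set vs -tf.
- exact: sub0set.
- by move=> s t _; rewrite inE.
- move=> s; rewrite in_setD1 => /andP[sf sD] _ _ v; have [vD vf kv kv'] := tog s sD sf.
  by split; rewrite ?inE ?vf.
- move=> s /(supported_bd_face_chain fn)/andP[]; rewrite !inE => sf /eqP sn.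
  rewrite sn eqxx (dD f) // !andbT; apply: contra_eq_neq fn => <-.
  by rewrite sn neq_ltn ltnSn.
- by move=> s _ _; rewrite boundary_sq ffunE.
exists u => //; apply/esym/eqP; rewrite -subr_eq0; apply/eqP/ffunP => s.
by have := u0 s; rewrite inE /= [RHS]ffunE; case: eqVneq => // _ /(_ isT).
Qed.

Lemma link_closed D r s t : (forall s t, t \subset s -> s \in D -> t \in D) ->
  t \subset s -> s \in link D r -> t \in link D r.
Proof.
move=> dD ts; rewrite !inE => /and3P[sD sr srD]; apply/and3P; split.
- exact: dD sD.
- exact: disjointWl sr.
- exact: dD (setSU _ ts) srD.
Qed.

(** A face t of the link is replaced by r = t :|: s, so that the matching is checked on faces of D
    above s; v outside s keeps the toggle in the link. *)
Lemma matching_link (W : finType) (key : {set V} -> {set W})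
    (pivot : {set W} -> V) D s i n :
    (forall s t, t \subset s -> key t \subset key s) ->
    (forall s t, t \subset s -> s \in D -> t \in D) ->
    (forall r, r \in D -> s \subset r -> #|r| = #|s| + n -> let v := pivot (key r) in
      [/\ v \notin s, v |: r \in D, key (v |: r) = key r & key (r :\ v) = key r])%N ->
  i + 1 = n%:Z -> rhomology K (link D s) i = 0%VS.
Proof.
move=> mkey dD tog; apply: (@matching_rhomology W (fun t => key (t :|: s)) pivot).
- by move=> r t tr; apply/mkey/setSU.
- by move=> r t; apply: link_closed.
move=> t tL tn v; move: (tL); rewrite inE => /and3P[tD ts tsD].
have [||vs vD kv kv'] := tog _ tsD; rewrite ?subsetUr //.
  by rewrite cardsU (disjoint_setI0 ts) cards0 subn0 tn addnC.
rewrite -setUA; split=> //; last first.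
  by rewrite -[RHS]kv' setDUl [s :\ _](setDidPl _) // disjoint_sym disjoints1.
rewrite inE -setUA vD -setI_eq0 setIUl setU_eq0 !setI_eq0 ts disjoints1 vs !andbT.
by apply: dD vD; rewrite setUA subsetUl.
Qed.

End Chains.

Local Open Scope nat_scope.

Lemma card_ord_ltn n i : i <= n -> #|[set r : 'I_n | r < i]| = i.
Proof.
by move=> le_in; rewrite -sum1dep_card -(big_ord_widen n (fun=> 1)) // sum1_card card_ord.
Qed.

(** * Numerical criterion for the faces of the partition complex *)

Section Faces.

Variables a p : nat.
Local Notation T := (vertex a p).
Implicit Types (s : {set T}) (t : 'I_p.+1) (j : 'I_a.-1).

Definition xs s : {set 'I_p.+1} := [set t | inl t \in s].
Definition ys s : {set 'I_p.+1} := [set t | [exists j, inr (t, j) \in s]].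

(* One less than the height of the column, and 0 on an empty column. *)
Definition excess s t : nat := \max_(j | inr (t, j) \in s) j.

(** Taking one off each of the i parts of a partition of a + i - 2 leaves a - 2, whatever i is;
    hence a bound on the total excess that does not mention i. *)
Definition face m s : bool :=
  [&& [disjoint xs s & ys s], #|ys s| <= m, xs s != setT
    & \sum_t excess s t <= a - 2].

Lemma ysP s t : reflect (exists j, inr (t, j) \in s) (t \in ys s).
Proof. by rewrite inE; apply: existsP. Qed.

Lemma leq_excess s t j : inr (t, j) \in s -> j <= excess s t.
Proof. by move=> sj; rewrite /excess (bigD1 j) //= leq_maxl. Qed.

Lemma excess_leqP s t n :
  reflect (forall j, inr (t, j) \in s -> j <= n) (excess s t <= n).
Proof. exact: bigmax_leqP. Qed.

Lemma excess_eq0 s t : t \notin ys s -> excess s t = 0.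
Proof.
move=> ts; apply/eqP; rewrite -leqn0; apply/excess_leqP => j sj.
by case/negP: ts; apply/ysP; exists j.
Qed.

Lemma excessS s s' t : s \subset s' -> excess s t <= excess s' t.
Proof. by move=> ss'; apply/excess_leqP => j /(subsetP ss')/leq_excess. Qed.

Lemma xsS s s' : s \subset s' -> xs s \subset xs s'.
Proof. by move=> ss'; apply/subsetP => t; rewrite !inE; apply: subsetP. Qed.

Lemma ysS s s' : s \subset s' -> ys s \subset ys s'.
Proof.
move=> ss'; apply/subsetP => t /ysP[j sj]; apply/ysP; exists j.
exact: subsetP sj.
Qed.

Lemma faceS m s s' : s \subset s' -> face m s' -> face m s.
Proof.
move=> ss' /and4P[dis cy nx ex]; apply/and4P; split.
- exact: disjointWl (xsS ss') (disjointWr (ysS ss') dis).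
- exact: leq_trans (subset_leq_card (ysS ss')) cy.
- by apply: contraNneq nx => xT; rewrite -subTset -xT xsS.
- by apply: leq_trans ex; apply: leq_sum => t _; apply: excessS.
Qed.

Lemma mem_vertex_act (g : 'S_p.+1) (A : {set T}) v :
  (v \in @vertex_act a p g @: A) = (@vertex_act a p g^-1 v \in A).
Proof.
rewrite (can_imset_pre _ (g := @vertex_act a p g^-1)) ?inE // => -[t|[t j]] /=;
by rewrite permK.
Qed.

(** Transported by the inverse of g, the x's of s have index at least i and its y's lie in columns
    below i, within the heights given by l. *)
Lemma partition_complex_face m s : 2 <= a -> m <= p.+1 ->
  s \in partition_complex a p m -> face m s.
Proof.
move=> ha hm; rewrite inE => /existsP[g /existsP[i /existsP[l]]].
set h := map val l => /and3P[i0 /and3P[_ h0 /eqP sh] /subsetP sG].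
have sz_h : size h = i by rewrite size_map size_tuple.
have xsP t : t \in xs s -> i <= (g^-1)%g t.
  by rewrite inE => /sG; rewrite mem_vertex_act inE.
have ysP' t j : inr (t, j) \in s -> ((g^-1)%g t < i) && (j < nth 0 h ((g^-1)%g t)).
  by move=> /sG; rewrite mem_vertex_act inE.
have im : i <= m by rewrite -ltnS.
apply/and4P; split.
- rewrite disjoints_subset; apply/subsetP => t /xsP it; rewrite in_setC.
  by apply/negP => /ysP[j /ysP'/andP[]]; rewrite ltnNge it.
- apply: (leq_trans _ im); rewrite -[leqRHS](@card_ord_ltn p.+1) ?(leq_trans im hm) //.
  rewrite -[leqRHS](card_imset _ (@perm_inj _ g)); apply/subset_leq_card/subsetP => t.
  move=> /ysP[j /ysP'/andP[ti _]]; apply/imsetP; exists ((g^-1)%g t); rewrite ?inE //.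
  by rewrite permKV.
(* Since i > 0, column 0 of [Gset] has no x, so the x of column [g ord0] is missing from s. *)
- apply/eqP => /setP/(_ (g ord0)); rewrite !inE => /idP gs.
  have := xsP (g ord0); rewrite inE permK => /(_ gs).
  by rewrite leqNgt i0.
- have {sh}: \sum_(t < i) (nth 0 h t).-1 + i = a + i - 2.
    rewrite -sh sumnE (big_nth 0) sz_h big_mkord.
    rewrite [in RHS](eq_bigr (fun t : 'I_i => (nth 0 h t).-1 + 1)) => [|t _].
      by rewrite big_split /= sum_nat_const card_ord muln1.
    by rewrite addn1 prednK // (allP h0) ?mem_nth ?sz_h.
  rewrite (big_ord_widen p.+1 (fun r => (nth 0 h r).-1)) ?(leq_trans im hm) // => sh.
  have -> : a - 2 = \sum_(t < p.+1 | t < i) (nth 0 h t).-1 by lia.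
  rewrite [leqRHS](reindex_inj (@perm_inj _ (g^-1)%g)) /= [leqRHS]big_mkcond /=.
  apply: leq_sum => t _; apply/excess_leqP => j /ysP'/andP[-> jh].
  by rewrite -ltnS (leq_trans jh) // leqSpred.
Qed.

(** Each column of a set S containing [ys s] gets a part at least its height, one column absorbing
    the slack left in the total; g lists S by decreasing part, then the other columns. *)
Lemma face_partition_complex m s : 0 < m -> 2 <= a ->
  face m s -> s \in partition_complex a p m.
Proof.
move=> m0 ha /and4P[dis cy nx ex].
(* A partition here has at least one part: when s has no y, S is a single column free of x. *)
have [S [t1 [t1S yS xS Sm]]] : exists S : {set 'I_p.+1}, exists t1 : 'I_p.+1,
    [/\ t1 \in S, ys s \subset S, [disjoint xs s & S] & #|S| <= m].
  have [y0|[t1 t1y]] := set_0Vmem (ys s); last by exists (ys s), t1.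
  have /subsetPn[t1 _ t1x] : ~~ ([set: 'I_p.+1] \subset xs s) by rewrite subTset.
  exists [set t1], t1; rewrite set11 y0 sub0set cards1; split=> //.
  by rewrite disjoint_sym disjoints1.
pose lam t := (excess s t).+1 + (if t == t1 then a - 2 - \sum_t excess s t else 0).
pose o1 := sort (fun t u => lam u <= lam t) (enum S).
pose o := o1 ++ enum (~: S).
have mem_o1 t : (t \in o1) = (t \in S) by rewrite mem_sort mem_enum.
have sz_o1 : size o1 = #|S| by rewrite size_sort -cardE.
have sz_o : size o = p.+1 by by rewrite size_cat sz_o1 -cardE cardsC card_ord.
have uo : uniq o.
  rewrite cat_uniq sort_uniq !enum_uniq andbT /=.
  by apply/hasPn => t; rewrite /= mem_enum mem_o1 inE.
have o_inj : injective (fun r : 'I_p.+1 => nth ord0 o r).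
  by move=> r r' /eqP; rewrite nth_uniq ?sz_o // => /eqP/val_inj.
pose g := perm o_inj.
pose h := map lam o1.
have sum_h : sumn h = a + #|S| - 2.
  rewrite sumnE big_map (perm_big (enum S)) ?perm_sort // big_enum /=.
  rewrite big_split /= [X in _ + X](bigD1 t1) //= eqxx [X in _ + (_ + X)]big1; last first.
    by move=> t /andP[_ /negPf->].
  rewrite (eq_bigr (fun t => excess s t + 1)) => [|t _]; last by rewrite addn1.
  rewrite big_split /= sum_nat_const muln1.
  have -> : \sum_(t in S) excess s t = \sum_t excess s t.
    rewrite [RHS](bigID (mem S)) /= [X in _ = _ + X]big1 ?addn0 // => t tS.
    by rewrite excess_eq0 //; apply: contra tS; apply: subsetP.
  by rewrite addn0 addnAC subnKC // addnBAC.
have sz_h : size h = #|S| by rewrite size_map.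
have h_le r : nth 0 h r <= a + #|S| - 2.
  have [rh|rh] := ltnP r (size h); last by rewrite nth_default.
  rewrite -sum_h -{2}(cat_take_drop r h) (drop_nth 0 rh) sumn_cat /= addnCA.
  exact: leq_addr.
(* [h_le] bounds the parts, so [inord] never falls back on its default value. *)
pose l := [tuple inord (nth 0 h r) | r < #|S|] : #|S|.-tuple 'I_(a + #|S| - 2).+1.
have lh : map val l = h.
  apply: (@eq_from_nth _ 0); rewrite size_map size_tuple ?sz_h // => r rS.
  rewrite (nth_map ord0) ?size_tuple // -[r]/(val (Ordinal rS)) -tnth_nth tnth_mktuple.
  by rewrite /= inordK // ltnS.
rewrite inE; apply/existsP; exists g; apply/existsP; exists (Ordinal (Sm : #|S| < m.+1)).
apply/existsP; exists l; rewrite lh /=; apply/and3P; split.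
- by apply/card_gt0P; exists t1.
- rewrite /is_partition sum_h eqxx andbT; apply/andP; split.
    by rewrite sorted_map; apply: sort_sorted => t u; apply: leq_total.
  by rewrite all_map; apply/allP.
- have g_index t : t \in o -> forall r : 'I_p.+1, index t o = r -> (g^-1)%g t = r.
    by move=> to r rt; apply: (@perm_inj _ g); rewrite permKV permE -rt nth_index.
  have o_all t : t \in o by rewrite mem_cat mem_o1 mem_enum inE orbN.
  have o_lt t : index t o < p.+1 by move: (o_all t); rewrite -index_mem sz_o.
  apply/subsetP => -[t|[t j]] sv; rewrite mem_vertex_act inE /=;
    rewrite (g_index t (o_all t) (Ordinal (o_lt t))) //= index_cat mem_o1.
    have tx : t \in xs s by rewrite inE.
    by rewrite (disjointFr xS tx) sz_o1 leq_addr.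
  have tS : t \in S by apply: (subsetP yS); apply/ysP; exists j.
  rewrite tS -sz_o1 index_mem mem_o1 tS /= (nth_map ord0) ?index_mem ?mem_o1 //.
  by rewrite nth_index ?mem_o1 // /lam addSn ltnS (leq_trans (leq_excess sv)) ?leq_addr.
Qed.

End Faces.

(** * Effect of adding or removing one vertex *)

Section Toggles.

Variables a p : nat.
Local Notation T := (vertex a p).
Implicit Types (s r : {set T}) (t u : 'I_p.+1) (j : 'I_a.-1).

Lemma xs_inl t s : xs ((inl t : T) |: s) = t |: xs s.
Proof. by apply/setP => u; rewrite !inE. Qed.

Lemma xs_inr t j s : xs ((inr (t, j) : T) |: s) = xs s.
Proof. by apply/setP => u; rewrite !inE. Qed.

Lemma ys_inl t s : ys ((inl t : T) |: s) = ys s.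
Proof. by apply/setP => u; rewrite !inE; apply: eq_existsb => j; rewrite !inE. Qed.

Lemma ys_inr t j s : ys ((inr (t, j) : T) |: s) = t |: ys s.
Proof.
apply/setP => u; rewrite in_setU1; apply/ysP/orP => [[k]|].
  rewrite !inE => /orP[/eqP[-> _]|uk]; first by left.
  by right; apply/existsP; exists k.
case=> [/eqP->|/ysP[k uk]]; first by exists j; rewrite setU11.
by exists k; rewrite setU1r.
Qed.

Lemma ysU s r : ys (s :|: r) = ys s :|: ys r.
Proof.
apply/setP => t; rewrite in_setU; apply/ysP/orP => [[j]|[]/ysP[j sj]].
- by rewrite in_setU => /orP[?|?]; [left|right]; apply/ysP; exists j.
- by exists j; rewrite in_setU sj.
- by exists j; rewrite in_setU sj orbT.
Qed.

Lemma xsU s r : xs (s :|: r) = xs s :|: xs r.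
Proof. by apply/setP => t; rewrite !inE. Qed.

Lemma excess_inl t s : excess ((inl t : T) |: s) =1 excess s.
Proof. by move=> u; apply: eq_bigl => j; rewrite !inE. Qed.

Lemma excess_inr t j s u :
  excess ((inr (t, j) : T) |: s) u = if u == t then maxn j (excess s t) else excess s u.
Proof.
case: eqP => [->|ut]; last first.
  by apply: eq_bigl => k; rewrite !inE; case: eqP => // -[].
apply/eqP; rewrite eqn_leq geq_max excessS ?subsetUr // leq_excess ?setU11 // !andbT.
apply/excess_leqP => k; rewrite !inE => /orP[/eqP[->]|/leq_excess kt].
  exact: leq_maxl.
by rewrite (leq_trans kt) ?leq_maxr.
Qed.

Lemma excess_gt0_ys s t : 0 < excess s t -> t \in ys s.
Proof. by apply: contraLR => /excess_eq0->. Qed.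

Lemma excess_attained s t : t \in ys s -> exists2 j, inr (t, j) \in s & excess s t = j.
Proof.
case/ysP => j sj; have [|k sk ek] := @eq_bigmax_cond _ (fun j => inr (t, j) \in s) val.
  by apply/card_gt0P; exists j.
by exists k.
Qed.

Lemma ys_inr_low t j s : t \in ys s -> ys ((inr (t, j) : T) |: s) = ys s.
Proof. by move=> ts; rewrite ys_inr; apply/setUidPr; rewrite sub1set. Qed.

Lemma excess_inr_low t j s : j <= excess s t -> excess ((inr (t, j) : T) |: s) =1 excess s.
Proof. by move=> jt u; rewrite excess_inr; case: eqP => // ->; apply/maxn_idPr. Qed.

(** Neither the set of nonempty columns nor any excess sees a y placed at or below the top of its
    column. *)
Lemma face_inr_low m t j s : t \in ys s -> j <= excess s t ->
  face m ((inr (t, j) : T) |: s) = face m s.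
Proof.
move=> ts jt; rewrite /face xs_inr ys_inr_low //.
by under eq_bigr do rewrite excess_inr_low //.
Qed.

Lemma face_inl m t s : t \notin ys s -> t |: xs s != setT -> face m s ->
  face m ((inl t : T) |: s).
Proof.
move=> ts xT /and4P[dis cy _ ex]; rewrite /face xs_inl ys_inl xT cy.
under eq_bigr do rewrite excess_inl.
by rewrite ex -setI_eq0 setIUl setU_eq0 !setI_eq0 dis disjoints1 ts.
Qed.

Lemma setD1_inr_low t j s : j < excess s t ->
  ys (s :\ inr (t, j)) = ys s /\ excess (s :\ inr (t, j)) =1 excess s.
Proof.
have [sj js|sj js] := boolP (inr (t, j) \in s); last first.
  suff -> : s :\ inr (t, j) = s by [].
  by apply/setDidPl; rewrite disjoint_sym disjoints1.
have js' : j < excess (s :\ inr (t, j)) t.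
  by move: js; rewrite -{1}(setD1K sj) excess_inr eqxx leq_max ltnn.
have ty := excess_gt0_ys (leq_ltn_trans (leq0n _) js').
by split=> [|u]; rewrite -{2}(setD1K sj) ?ys_inr_low // excess_inr_low // ltnW.
Qed.

Lemma ys_setD1_inl t s : ys (s :\ inl t) = ys s.
Proof. by apply/setP => u; rewrite !inE; apply: eq_existsb => j; rewrite !inE. Qed.

Lemma excess_setD1_inl t s : excess (s :\ inl t) =1 excess s.
Proof. by move=> u; apply: eq_bigl => j; rewrite !inE. Qed.

Lemma xs_setD1_inr t j s : xs (s :\ inr (t, j)) = xs s.
Proof. by apply/setP => u; rewrite !inE. Qed.

Lemma card_no_ys s : ys s = set0 -> #|s| = #|xs s|.
Proof.
move=> ys0; have nj t j : inr (t, j) \notin s.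
  by apply/negP => sj; have : t \in ys s; [apply/ysP; exists j | rewrite ys0 inE].
rewrite -sum1_card big_sumType /= [X in _ + X]big_pred0 => [|[t j]].
  by rewrite addn0 sum1dep_card.
exact: negbTE.
Qed.

Definition column_closed s :=
  forall t j, t \in ys s -> j <= excess s t -> inr (t, j) \in s.

(** A nonempty column without gaps has one more y than its excess. *)
Lemma card_column_closed s : column_closed s ->
  #|s| = #|xs s| + #|ys s| + \sum_t excess s t.
Proof.
move=> ng; rewrite -sum1_card big_sumType /= -addnA; congr (_ + _).
  by rewrite sum1dep_card.
transitivity (\sum_t \sum_(j | inr (t, j) \in s) 1).
  rewrite pair_big_dep /=; apply: eq_bigl => -[t j] //=.
rewrite -sum1_card [X in _ = X + _]big_mkcond -big_split /=; apply: eq_bigr => t _.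
case: ifPn => ts; last first.
  rewrite excess_eq0 // big1 // => j sj.
  by case/negP: ts; apply/ysP; exists j.
rewrite add1n -[RHS](@card_ord_ltn a.-1); last by have [j _ ->] := excess_attained ts.
rewrite sum1dep_card; apply: eq_card => j; rewrite !inE ltnS.
by apply/idP/idP => [/leq_excess|/(ng t j ts)].
Qed.

End Toggles.

(** The choice depends on A alone, so a pivot made from it is a function of the key; the default is
    taken at the empty set only. *)
Definition pick_in (W : finType) (x0 : W) (A : {set W}) : W := odflt x0 [pick x in A].

Lemma pick_in_setC (W : finType) (x0 : W) (A : {set W}) :
  A != setT -> pick_in x0 (~: A) \notin A.
Proof.
rewrite -subTset => /subsetPn[x _ xA]; rewrite /pick_in; case: pickP => /= [y|/(_ x)].
  by rewrite inE.
by rewrite inE xA.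
Qed.

(** * Vanishing homology of links *)

Section Links.

Variables (K : fieldType) (a p m : nat).
Hypotheses (ha : 2 <= a) (hm : 1 <= m <= p).
Local Notation T := (vertex a p).
Local Notation P := (partition_complex a p m).
Implicit Types (s r : {set T}) (t u : 'I_p.+1) (j : 'I_a.-1).

Lemma mem_partition_complex s : (s \in P) = face m s.
Proof.
have [m0 mp] := andP hm; apply/idP/idP.
  by apply: partition_complex_face => //; apply: leqW.
exact: face_partition_complex.
Qed.

Lemma partition_complex_closed s r : r \subset s -> s \in P -> r \in P.
Proof. by rewrite !mem_partition_complex; apply: faceS. Qed.

Lemma mem_link s r : (r \in link P s) = [disjoint r & s] && face m (r :|: s).
Proof.
rewrite /link in_set !mem_partition_complex; case: (boolP (face m (r :|: s))) => fr.
  by rewrite (faceS (subsetUl r s) fr).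
by rewrite !andbF.
Qed.

Let a1_gt0 : 0 < a.-1. Proof. by rewrite -subn1 subn_gt0. Qed.
Let low0 : 'I_a.-1 := Ordinal a1_gt0.

(** The key is constant: a y below the top can be added to every face above s, so the link is a
    cone. *)
Lemma link_gap s t j i n : inr (t, j) \notin s -> j < excess s t ->
  (i + 1 = n%:Z)%R -> rhomology K (link P s) i = 0%VS.
Proof.
move=> js jt; apply: (@matching_link _ _ _ (fun=> set0 : {set unit}) (fun=> inr (t, j))).
- by move=> *; apply: sub0set.
- exact: partition_complex_closed.
move=> r rP sr _ /=; split=> //; move: rP; rewrite !mem_partition_complex.
have jr : j < excess r t := leq_trans jt (excessS _ sr).
rewrite face_inr_low //; last exact: ltnW.
exact: excess_gt0_ys (leq_ltn_trans (leq0n _) jr).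
Qed.

Lemma link_column_closed s i n : (i + 1 = n%:Z)%R ->
  rhomology K (link P s) i != 0%VS -> column_closed s.
Proof.
move=> hi nz t j ts; rewrite leq_eqVlt => /orP[/eqP je|jt].
  by have [k sk ek] := excess_attained ts; rewrite (_ : j = k) //; apply/val_inj; rewrite /= je ek.
by apply: contraNT nz => js; rewrite (link_gap js jt hi).
Qed.

(** The key is the set of x's, and the pivot is the bottom y of a column t free of x. The columns
    with a y, and t, all lie in the complement of [xs s], so there are at most m of them, and a
    bottom y adds no excess. *)
Lemma link_xs_small s i n : ys s = set0 -> #|~: xs s| <= m ->
  (i + 1 = n%:Z)%R -> rhomology K (link P s) i = 0%VS.
Proof.
move=> ys0 km; apply: (@matching_link _ _ _ (@xs a p)
    (fun S => inr (pick_in ord0 (~: S), low0))).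
- by move=> r r'; apply: xsS.
- exact: partition_complex_closed.
move=> r; rewrite !mem_partition_complex => fr sr _ /=.
have /and4P[dis cy nx ex] := fr; set t := pick_in _ _.
have tx : t \notin xs r by exact: pick_in_setC.
have dis' : [disjoint xs r & t |: ys r].
  by rewrite disjoint_sym -setI_eq0 setIUl setU_eq0 !setI_eq0 disjoints1 tx disjoint_sym.
rewrite mem_partition_complex xs_inr xs_setD1_inr; split=> //.
  by apply/negP => vs; have : t \in ys s; [apply/ysP; exists low0 | rewrite ys0 inE].
rewrite /face xs_inr ys_inr dis' nx /=; apply/andP; split.
  apply: leq_trans km; apply: subset_leq_card; rewrite subsetC.
  by apply: subset_trans (xsS sr) _; rewrite -disjoints_subset.
by under eq_bigr do rewrite excess_inr_low //.
Qed.

Lemma xs_inl_neqT s t u : t \notin ys s -> u \in ys s -> face m s ->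
  t |: xs s != setT.
Proof.
move=> ts us /and4P[dis _ _ _]; apply/eqP => /setP/(_ u).
rewrite in_setU1 in_setT (disjointFl dis us) orbF => /eqP ut.
by rewrite -ut us in ts.
Qed.

(** The key is the set of columns with a y. There are at most m of these, so some column with no x
    in s is not among them, and its x is the pivot. *)
Lemma link_xs_large s i n : ys s = set0 -> m < #|~: xs s| -> #|s| + n != p ->
  (i + 1 = n%:Z)%R -> rhomology K (link P s) i = 0%VS.
Proof.
move=> ys0 km snp; apply: (@matching_link _ _ _ (@ys a p)
    (fun S => inl (pick_in ord0 (~: (xs s :|: S))))).
- by move=> r r'; apply: ysS.
- exact: partition_complex_closed.
move=> r; rewrite !mem_partition_complex => fr sr cr /=.
have /and4P[dis cy nx _] := fr; set t := pick_in _ _.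
have : t \notin xs s :|: ys r.
  apply: pick_in_setC; apply: contraTneq km => sT; rewrite -leqNgt.
  by apply: leq_trans cy; apply: subset_leq_card; rewrite -setTD -sT subDset.
rewrite in_setU negb_or => /andP[ts tr].
rewrite mem_partition_complex ys_inl ys_setD1_inl; split=> //.
  by rewrite inE in ts.
apply: face_inl => //; have [y0|[u ur]] := set_0Vmem (ys r); last exact: xs_inl_neqT ur fr.
(* Adding x_t can fail only when r consists of all x's but x_t, and then r has p elements. *)
apply: contraNneq snp => tT; rewrite -cr (card_no_ys y0).
have tx : t \notin xs r.
  by apply: contraNN nx => tx; rewrite -tT eqEsubset subsetUr subUset sub1set tx /=.
by have := cardsU1 t (xs r); rewrite tT tx cardsT card_ord => -[tp]; apply/eqP/esym.
Qed.

Lemma excess_lt r t : excess r t < a.-1.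
Proof.
have [/excess_attained[j _ ->] //|/excess_eq0->] := boolP (t \in ys r).
exact: ltn_ord low0.
Qed.

(** * Vanishing for links of faces containing a y *)

Section LowestFree.

Variable s : {set T}.
Hypotheses (s_closed : column_closed s).

(* The lowest y outside s in column t; low t is a junk value if the column is
   full, that is base t = a - 1. *)
Let base t := if t \in ys s then (excess s t).+1 else 0.
Let low t : 'I_a.-1 := insubd low0 (base t).

(** The left copy of the columns records where r has a y, the right copy where r rises above the
    lowest free y of s; both grow with r. *)
Let key r : {set 'I_p.+1 + 'I_p.+1} :=
  [set w | match w with inl t => t \in ys r | inr t => base t < excess r t end].

Let in_key r w :
  (w \in key r) = match w with inl t => t \in ys r | inr t => base t < excess r t end.
Proof. by rewrite in_set. Qed.

Let lowE t : base t < a.-1 -> low t = base t :> nat.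
Proof. by move=> bt; rewrite val_insubd bt. Qed.

Let low_notin t : base t < a.-1 -> inr (t, low t) \notin s.
Proof.
move=> bt; apply/negP => sl; have ts : t \in ys s by apply/ysP; exists (low t).
by have := leq_excess sl; rewrite lowE // /base ts ltnn.
Qed.

Let keyS r r' : r \subset r' -> key r \subset key r'.
Proof.
move=> rr'; apply/subsetP => -[t|t]; rewrite !in_key.
  exact/subsetP/ysS.
by move=> /leq_trans -> //; apply: excessS.
Qed.

(** The added y is at position [base t], which the strict inequality in the key does not see. *)
Let key_low r t : base t < a.-1 -> t \in ys r ->
  key ((inr (t, low t) : T) |: r) = key r.
Proof.
move=> bt tr; apply/setP => -[u|u]; rewrite !in_key ?ys_inr_low //.
rewrite excess_inr; case: eqP => // ->.
by rewrite leq_max lowE // ltnn.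
Qed.

Let key_lowD r t : base t < a.-1 -> t \in ys (r :\ inr (t, low t)) ->
  key (r :\ inr (t, low t)) = key r.
Proof.
move=> bt tr; have [lr|lr] := boolP (inr (t, low t) \in r).
  by rewrite -{2}(setD1K lr) key_low.
suff -> : r :\ inr (t, low t) = r by [].
by apply/setDidPl; rewrite disjoint_sym disjoints1.
Qed.

(** Outside s, r has no x, and in each column at most one y, at position [base t]; hence no gaps. If
    r does not rise above s in column t0, this column contributes no such y although it belongs to
    [ys r]. *)
Let saturated r : s \subset r -> [disjoint xs r & ys r] -> xs s :|: ys r = setT ->
    (forall t, excess r t <= base t) ->
  column_closed r /\ forall t0, t0 \in ys s -> excess r t0 <= excess s t0 ->
    #|r :\: s| < #|ys r|.
Proof.
move=> sr dis rT rb; have base_le t j : inr (t, j) \notin s -> base t <= j.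
  move=> js; rewrite /base; case: ifP => // ts; rewrite ltnNge.
  by apply: contra js; apply: s_closed.
split.
  move=> t j tr jt; have [js|js] := boolP (inr (t, j) \in s).
    exact: (subsetP sr).
  have jb : base t = j by apply/eqP; rewrite eqn_leq base_le // (leq_trans jt).
  have [k rk ek] := excess_attained tr; rewrite (_ : j = k) //; apply/val_inj.
  by apply/eqP; rewrite /= -ek eqn_leq jt -jb rb.
(* Sending a vertex to its column is injective on r :\: s and misses t0. *)
move=> t0 t0s et0; pose col (v : T) := match v with inl t => t | inr (t, _) => t end.
have rsP v : v \in r :\: s -> exists t j, [/\ v = inr (t, j), inr (t, j) \in r & base t = j].
  move=> /setDP[]; case: v => [t|[t j]] vr vs.
    have : t \in xs s :|: ys r by rewrite rT.
    rewrite in_setU (disjointFr dis) ?inE // orbF => ts.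
    by rewrite ts in vs.
  exists t, j; split=> //; apply/eqP; rewrite eqn_leq base_le //=.
  by rewrite (leq_trans _ (rb t)) ?leq_excess.
rewrite -(@card_in_imset _ _ col (mem (r :\: s))); last first.
  move=> v w /rsP[t [j [-> _ tj]]] /rsP[u [k [-> _ uk]]] /= tu.
  by rewrite -tu in uk *; rewrite (_ : j = k) //; apply/val_inj; rewrite /= -tj -uk.
have t0r : t0 \in ys r by apply: subsetP t0s; apply: ysS.
rewrite [X in _ < X](cardsD1 t0) t0r ltnS; apply/subset_leq_card/subsetP => u.
move=> /imsetP[v /rsP[t [j [-> rj tj]]] ->] /=; rewrite in_setD1 andbC.
apply/andP; split; first by apply/ysP; exists j.
apply/eqP => tt0; rewrite tt0 in rj tj.
by have := leq_trans (leq_excess rj) et0; rewrite -tj /base t0s ltnn.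
Qed.

(** The pivot is the lowest free y of a column rising above it, else the x of a column with no x in
    s and no y in r, else the lowest free y of a fixed column t0 of s. Only the last can fail, and
    then r has no gaps and has p + a - 1 elements, with n < m. *)
Lemma link_ys i n : ys s != set0 -> ~~ ((n < m) && (#|s| + n == p + a - 1)) ->
  (i + 1 = n%:Z)%R -> rhomology K (link P s) i = 0%VS.
Proof.
move=> /set0Pn[t0 t0s] nn.
pose pivot (k : {set 'I_p.+1 + 'I_p.+1}) : T :=
  if [pick t | inr t \in k] is Some t then inr (t, low t)
  else if [pick t | (t \notin xs s) && (inl t \notin k)] is Some t then inl t
  else inr (t0, low t0).
apply: (@matching_link _ _ _ key pivot).
- by move=> r r'; apply: keyS.
- exact: partition_complex_closed.
move=> r; rewrite mem_partition_complex => fr sr cr /=; rewrite /pivot mem_partition_complex.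
have t0r : t0 \in ys r by apply: subsetP t0s; apply: ysS.
case: pickP => [t|nbad].
  rewrite in_key => bt; have ba : base t < a.-1 by apply: ltn_trans bt (excess_lt r t).
  have tr : t \in ys r by apply: excess_gt0_ys; apply: leq_ltn_trans bt.
  rewrite low_notin // face_inr_low ?lowE //; last exact: ltnW.
  split=> //; first exact: key_low.
  by apply: key_lowD => //; rewrite (setD1_inr_low _).1 ?lowE.
have rb t : excess r t <= base t by have := nbad t; rewrite in_key ltnNge => /negbFE.
case: pickP => [t|nfree].
  move=> /andP[ts]; rewrite in_key => tr; split.
  - by rewrite inE in ts.
  - by apply: face_inl => //; apply: xs_inl_neqT t0r fr.
  - by apply/setP => -[u|u]; rewrite !in_key ?ys_inl ?excess_inl.
  - by apply/setP => -[u|u]; rewrite !in_key ?ys_setD1_inl ?excess_setD1_inl.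
have rT : xs s :|: ys r = setT.
  apply/setP => t; rewrite in_setU in_setT; have := nfree t.
  by rewrite in_key; case: (t \in xs s); case: (t \in ys r).
have /and4P[dis cy nx ex] := fr.
have [closed_r lt_rs] := saturated sr dis rT rb.
suff [bt flr] : base t0 < a.-1 /\ face m ((inr (t0, low t0) : T) |: r).
  split=> //; first exact: low_notin.
    exact: key_low.
  apply: key_lowD => //; apply: subsetP t0s; apply: ysS.
  by rewrite subsetD1 sr low_notin.
(* If r rises above s in column t0, its top there is exactly the lowest free y, so adding that y
   changes nothing. *)
have [e0|e0] := leqP (excess r t0) (excess s t0); last first.
  have eb : excess r t0 = base t0 by apply/eqP; rewrite eqn_leq rb /base t0s.
  have bt : base t0 < a.-1 by rewrite -eb excess_lt.
  by split=> //; rewrite face_inr_low ?eb ?lowE.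
have er : excess r t0 = excess s t0 by apply/eqP; rewrite eqn_leq e0 excessS.
(* When the total excess is already a - 2, counting r by columns gives the excluded case; otherwise
   t0 is not full and may rise by one. *)
have [full|lt_ex] := leqP (a - 2) (\sum_t excess r t).
  have {}ex : \sum_t excess r t = a - 2 by apply/eqP; rewrite eqn_leq ex.
  have xyT : #|xs r| + #|ys r| = p.+1.
    rewrite -cardsUI (disjoint_setI0 dis) cards0 addn0.
    suff -> : xs r :|: ys r = setT by rewrite cardsT card_ord.
    by apply/eqP; rewrite -subTset -rT setSU ?xsS.
  have nlt : n < m.
    apply: leq_trans cy; apply: leq_trans (lt_rs t0 t0s e0).
    by rewrite cardsDS // cr addKn.
  case/negP: nn; rewrite nlt -cr (card_column_closed closed_r) xyT ex.
  by apply/eqP; move: ha; clear; lia.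
have bt : base t0 < a.-1.
  rewrite /base t0s -er; apply: (@leq_ltn_trans (\sum_t excess r t).+1).
    by rewrite ltnS (bigD1 t0) //= leq_addr.
  by move: lt_ex; clear; lia.
split=> //; rewrite /face xs_inr ys_inr_low // dis cy nx /=.
apply: leq_trans lt_ex.
have -> : \sum_t excess ((inr (t0, low t0) : T) |: r) t = \sum_t (excess r t + (t == t0)).
  apply: eq_bigr => u _; rewrite excess_inr; case: eqP => [->|_]; last by rewrite addn0.
  by rewrite lowE // /base t0s -er addn1; apply/maxn_idPl.
rewrite big_split /= [X in _ + X](bigD1 t0) //= [X in _ + (_ + X)]big1 ?eqxx ?addn1 //.
by move=> u /negPf->.
Qed.

End LowestFree.

(** The size of the faces whose links have homology in degree n - 1; it drops by a from n = m - 1 to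
    n = m and by 1 elsewhere. *)
Definition homology_card n := if m <= n then p - n else p + a - 1 - n.

Lemma link_rhomology_card s i : s \in P -> rhomology K (link P s) i != 0%VS ->
  exists2 n, (i + 1 = n%:Z)%R & (n <= p) && (#|s| == homology_card n).
Proof.
move=> sP nz; have [n hi _] := (rhomology_neq0P K (link P s) i).1 nz.
exists n => //; rewrite /homology_card; have [m0 mp] := andP hm.
have [ys0|ysN0] := eqVneq (ys s) set0.
  have [km|km] := leqP #|~: xs s| m; first by rewrite (link_xs_small ys0 km hi) eqxx in nz.
  have /eqP sn : #|s| + n == p by apply: contraNT nz => sn; rewrite (link_xs_large ys0 km sn hi).
  have := cardsC (xs s); rewrite card_ord -(card_no_ys ys0) => cs.
  (* Exactly n + 1 columns are free of x, and these are more than m. *)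
  have -> : m <= n by lia.
  by apply/andP; split; [|apply/eqP]; lia.
have /andP[nm /eqP sn] : (n < m) && (#|s| + n == p + a - 1).
  apply: contraNT (nz) => nn.
  by rewrite (link_ys (link_column_closed hi nz) ysN0 nn hi).
rewrite (leqNgt m) nm /=; apply/andP; split; first by lia.
by rewrite -sn addnK.
Qed.

(** * Nonvanishing homology of links *)

Lemma link_inl t s r : ys (r :|: s) != set0 -> t \notin xs s -> t \notin ys (r :|: s) ->
  r \in link P s -> (inl t : T) |: r \in link P s.
Proof.
move=> /set0Pn[u ur] ts tr; rewrite !mem_link => /andP[rs frs]; apply/andP; split.
  by rewrite -setI_eq0 setIUl setU_eq0 !setI_eq0 rs disjoints1 andbT; rewrite inE in ts.
by rewrite -setUA; apply: face_inl => //; apply: xs_inl_neqT ur frs.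
Qed.

(** The cycle is the boundary of the simplex X on the n + 1 x's missing from s, X itself not being
    in the link. If it bounded u in the link, toggling x's in faces with a y would make u a
    boundary, so that the boundary of X would be 0. *)
Lemma link_xs_rhomology s i n : s \in P -> ys s = set0 -> m < #|~: xs s| ->
  #|s| + n = p -> (i + 1 = n%:Z)%R -> rhomology K (link P s) i != 0%VS.
Proof.
move=> sP ys0 km sn hi.
pose X : {set T} := [set v | match v with inl t => t \notin xs s | inr _ => false end].
have xsX : xs X = ~: xs s by apply/setP => t; rewrite !inE.
have ysX : ys X = set0.
  by apply/setP => t; rewrite in_set0; apply/negP => /ysP[j]; rewrite inE.
have cX : #|X| = n.+1.
  have := cardsC (xs s); rewrite card_ord -(card_no_ys ys0) -xsX -(card_no_ys ysX); lia.
apply/rhomology_neq0P; exists n => //; exists (boundary_fun (face_chain K X)).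
split; [|exact: boundary_sq|].
  move=> r /(supported_bd_face_chain cX); rewrite inE => /andP[rX /eqP rn].
  have rs : [disjoint r & s].
    rewrite disjoints_subset; apply/subsetP => v /(subsetP rX); rewrite inE in_setC.
    by case: v => // t; rewrite inE.
  have rsP : face m (r :|: s).
    have ys_rs : ys (r :|: s) = set0.
      by apply/eqP; rewrite ysU ys0 setU0 -subset0 -ysX ysS.
    rewrite /face ys_rs cards0 -setI_eq0 setI0 eqxx /=.
    rewrite big1 ?andbT => [|t _]; last by rewrite excess_eq0 // ys_rs inE.
    apply/eqP => xT; have := cardsT 'I_p.+1; rewrite -xT -card_no_ys // card_ord.
    rewrite cardsU (disjoint_setI0 rs) cards0 subn0 rn addnC sn.
    by move/eqP; rewrite -[_ == _]negbK neq_ltn ltnSn.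
  by rewrite mem_link rs rsP rn eqxx.
move=> u uD; apply/eqP => bu.
pose D0 := [set r in link P s | ys r == set0].
have in_D0 r : (r \in D0) = (r \in link P s) && (ys r == set0).
  by rewrite [LHS]inE.
have inD0 r : r \in link P s -> r \notin D0 -> ys r != set0.
  by move=> rL; rewrite in_D0 rL.
have [|||||||u' u'D uu'] := @matching_reduction K T _ (@ys a p)
    (fun S => inl (pick_in ord0 (~: (xs s :|: S)))) (link P s) D0 n.+1 u.
- by move=> r r'; apply: ysS.
- by move=> r r'; apply: link_closed; apply: partition_complex_closed.
- by apply/subsetP => r; rewrite in_D0 => /andP[].
- move=> r r' rr'; rewrite !in_D0 => /andP[rL /eqP ry].
  rewrite (link_closed _ rr') //; last exact: partition_complex_closed.
  by rewrite -subset0 -ry ysS.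
- move=> r rL rD0 _ /=; have ry := inD0 r rL rD0; set t := pick_in _ _.
  have : t \notin xs s :|: ys r.
    apply: pick_in_setC; apply: contraTneq km => sT; rewrite -leqNgt.
    move: rL; rewrite mem_link => /andP[_ /and4P[_ + _ _]].
    rewrite ysU ys0 setU0; apply: leq_trans; apply: subset_leq_card.
    by rewrite -setTD -sT subDset.
  rewrite in_setU negb_or => /andP[ts tr].
  rewrite ys_inl ys_setD1_inl link_inl ?ysU ?ys0 ?setU0 //.
  by split=> //; rewrite in_D0 ys_setD1_inl (negPf ry) andbF.
- by [].
- move=> r rL rD0; rewrite bu; apply/eqP; apply: contraNT (inD0 r rL rD0).
  move=> /(supported_bd_face_chain cX); rewrite inE => /andP[rX _].
  by rewrite -subset0 -ysX ysS.
(* The link has no face of size n + 1 without y: together with s it would give all p + 1 x's. *)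
have uE : u = boundary_fun u'.
  apply/eqP; rewrite -subr_eq0; apply/eqP/ffunP => r; rewrite [RHS]ffunE.
  apply/eqP; apply: contraT => /uu'/andP[]; rewrite in_D0 => /andP[rL /eqP ry] /eqP rn.
  move: rL; rewrite mem_link => /andP[rs /and4P[_ _ nT _]].
  case/negP: nT; rewrite eqEcard subsetT cardsT card_ord -card_no_ys ?ysU ?ry ?ys0 ?setU0 //.
  by rewrite cardsU (disjoint_setI0 rs) cards0 subn0 rn addSn addnC sn leqnn.
have X0 : X != set0 by rewrite -card_gt0 cX.
have /eqP[] := bd_face_chain_neq0 K X0.
by rewrite -bu uE boundary_sq.
Qed.

(** The full column t0 uses up the excess a - 2, so each of the n columns of F may hold x_t or the
    bottom y, independently: the link is the boundary of a cross-polytope. Its facet f of all bottom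
    y's is the one left unmatched. *)
Lemma link_ys_rhomology s t0 i n : s \in P -> ys s = [set t0] ->
    (forall j, inr (t0, j) \in s) -> #|~: (xs s :|: ys s)| = n -> n < m ->
  (i + 1 = n%:Z)%R -> rhomology K (link P s) i != 0%VS.
Proof.
move=> sP ys0 sj cF nm hi; set F := ~: (xs s :|: ys s) in cF.
have fs : face m s by rewrite -mem_partition_complex.
have /and4P[dis_s _ nx ex_s] := fs.
have lt_top : a - 2 < a.-1 by move: ha; clear; lia.
have s_full : a - 2 <= excess s t0 by rewrite (@leq_excess _ _ _ _ (Ordinal lt_top)).
pose f : {set T} := [set v |
  match v with inl _ => false | inr (t, j) => (t \in F) && (j == low0) end].
have ysf : ys f = F.
  apply/setP => t; apply/ysP/idP => [[j]|tF]; first by rewrite inE => /andP[].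
  by exists low0; rewrite inE tF eqxx.
have fE t j : (inr (t, j) \in f) = (t \in F) && (j == low0) by rewrite inE.
have fF t : (t \in F) = (t \notin xs s) && (t \notin ys s) by rewrite in_setC in_setU negb_or.
have link_inr r t j : r \in link P s -> inr (t, j) \in r -> inr (t, j) \in f.
  rewrite mem_link => /andP[rs /and4P[dis _ _ ex]] rj.
  have t0t : t != t0 by apply: contraTneq rj => ->; rewrite (disjointFl rs).
  have tr : t \in ys (r :|: s) by apply/ysP; exists j; rewrite in_setU rj.
  rewrite fE fF ys0 in_set1 t0t andbT; apply/andP; split.
    have := disjointFl dis tr; rewrite xsU in_setU => /negbT.
    by rewrite negb_or => /andP[].
  (* Columns t0 and t together have excess at least a - 2 + j, which forces j = 0. *)
  apply/eqP/val_inj/eqP; rewrite /= -leqn0 -(leq_add2l (a - 2)) addn0.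
  apply: leq_trans ex; rewrite (bigD1 t0) //= (bigD1 t) //= addnA.
  apply: leq_trans (leq_addr _ _); apply: leq_add.
    exact: leq_trans s_full (excessS _ (subsetUr _ _)).
  by apply: leq_excess; rewrite in_setU rj.
have link_inl_notin r t : r \in link P s -> inl t \in r ->
    (t \notin xs s) && (t \notin ys (r :|: s)).
  rewrite mem_link => /andP[rs /and4P[dis _ _ ex]] rt; apply/andP; split.
    by rewrite inE (disjointFr rs).
  by rewrite (disjointFr dis) // xsU in_setU inE rt.
have f_s : f \in link P s.
  rewrite mem_link; apply/andP; split.
    rewrite disjoints_subset; apply/subsetP => -[t|[t j]]; first by rewrite inE.
    rewrite fE fF => /andP[/andP[_ ts] _]; rewrite in_setC; apply: contra ts => ts.
    by apply/ysP; exists j.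
  have xf : xs (f :|: s) = xs s by apply/setP => t; rewrite xsU in_setU inE [inl t \in f]inE.
  rewrite /face xf nx ysU ysf; apply/and4P; split=> //.
  - by rewrite -setI_eq0 setIUr setU_eq0 !setI_eq0 dis_s andbT disjoints_subset setCK subsetUl.
  - apply: leq_trans nm; rewrite (leq_trans (leq_card_setU _ _)) // cF ys0 cards1 addn1 //.
  - apply: leq_trans ex_s; apply: leq_sum => t _; apply/excess_leqP => j.
    by rewrite in_setU fE => /orP[/andP[_ /eqP->] //|/leq_excess].
have ysf_s : xs s :|: ys (f :|: s) = setT.
  by rewrite ysU ysf setUCA setUC setUCr.
apply: (@facet_rhomology _ _ _ (fun r => ys (r :|: s))
    (fun S => inl (pick_in ord0 (~: (xs s :|: S)))) _ f _ n) => //.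
- by move=> r r' rr'; apply/ysS/setSU.
- by move=> r r'; apply: link_closed; apply: partition_complex_closed.
- rewrite -cF -(card_imset _ (pcan_inj (f := fun t : 'I_p.+1 => inr (t, low0) : T)
      (g := fun v => if v is inr (t, _) then Some t else None) (fun=> erefl))).
  apply: eq_card => -[t|[t j]]; rewrite ?fE.
    by rewrite inE; apply/esym/negbTE/imsetP => -[].
  by apply/andP/imsetP => [[tF /eqP->]|[u uF [-> ->]]]; [exists t|].
- move=> [t|[t j]] vf; last by apply: link_inr vf _; rewrite setU11.
  have /andP[ts] := link_inl_notin _ _ vf (setU11 _ _).
  have : t \in xs s :|: ys (f :|: s) by rewrite ysf_s.
  by rewrite in_setU (negPf ts) -setUA ys_inl /= => ->.
move=> r rL rf /=; set t := pick_in _ _.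
have : t \notin xs s :|: ys (r :|: s).
  (* If every column with no x in s has a y in r or s, then r is f. *)
  apply: pick_in_setC; apply: contraNneq rf => rT.
  rewrite eqEsubset; apply/andP; split; apply/subsetP => -[u|[u j]].
  - move=> /(link_inl_notin r u rL) /andP[us ur].
    have : u \in xs s :|: ys (r :|: s) by rewrite rT.
    by rewrite in_setU (negPf us) (negPf ur).
  - exact: link_inr.
  - by rewrite inE.
  rewrite fE fF => /andP[/andP[us uy] /eqP ->].
  have : u \in xs s :|: ys (r :|: s) by rewrite rT.
  rewrite in_setU (negPf us) ysU in_setU (negPf uy) orbF /= => /ysP[k rk].
  by have := link_inr r u k rL rk; rewrite fE => /andP[_ /eqP <-].
rewrite in_setU negb_or => /andP[ts tr].
have rs0 : ys (r :|: s) != set0 by apply/set0Pn; exists t0; rewrite ysU in_setU ys0 set11 orbT.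
split; first exact: link_inl.
- by apply/eqP => /setP/(_ (inl t)); rewrite setU11 inE.
- by rewrite -setUA ys_inl.
- by rewrite !ysU ys_setD1_inl.
Qed.

Lemma has_link_homology_card q : q <= p -> has_link_homology K P (q%:Z - 1)%R.
Proof.
move=> qp; have hq : (q%:Z - 1 + 1 = q%:Z)%R by rewrite subrK.
pose A : {set 'I_p.+1} := [set t : 'I_p.+1 | t < p - q].
have cA : #|A| = p - q by apply: card_ord_ltn; apply: leqW; apply: leq_subr.
have [m0 mp] := andP hm; have [mq|qm] := leqP m q.
  (* These p - q x's leave q + 1 > m columns free. *)
  pose s : {set T} := [set v | match v with inl t => t \in A | inr _ => false end].
  have xss : xs s = A by apply/setP => t; rewrite !inE.
  have yss : ys s = set0.
    by apply/setP => t; rewrite in_set0; apply/negP => /ysP[j]; rewrite inE.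
  have cxs : #|~: xs s| = q.+1.
    by have := cardsC (xs s); rewrite xss cA card_ord; lia.
  have sP : s \in P.
    rewrite mem_partition_complex /face yss cards0 -setI_eq0 setI0 eqxx /=.
    rewrite big1 ?andbT => [|t _]; last by rewrite excess_eq0 // yss inE.
    by apply/eqP => xT; rewrite xT setCT cards0 in cxs.
  exists s => //; apply: (link_xs_rhomology sP yss _ _ hq); first by rewrite cxs.
  by rewrite card_no_ys // xss cA subnK.
(* Besides p - q x's, the last column is filled with all its y's; it is not in A, and q columns stay
   empty. *)
pose s : {set T} := [set v | match v with inl t => t \in A | inr (t, _) => t == ord_max end].
have xss : xs s = A by apply/setP => t; rewrite !inE.
have yss : ys s = [set ord_max].
  apply/setP => t; rewrite in_set1; apply/ysP/eqP => [[j]|->]; first by rewrite inE => /eqP.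
  by exists low0; rewrite inE.
have maxA : ord_max \notin A by rewrite inE -leqNgt leq_subr.
have sP : s \in P.
  rewrite mem_partition_complex /face xss yss cards1 m0 disjoint_sym disjoints1 maxA /=.
  apply/andP; split; first by apply/eqP => /setP/(_ ord_max); rewrite (negPf maxA) inE.
  rewrite (bigD1 ord_max) //= big1 ?addn0 => [|t tm]; last by rewrite excess_eq0 // yss inE.
  by have := excess_lt s ord_max; move: ha; clear; lia.
exists s => //; apply: (link_ys_rhomology sP yss _ _ qm hq); first by move=> j; rewrite inE.
have := cardsC (xs s :|: ys s); rewrite {1}xss {1}yss setUC cardsU1 maxA cA card_ord.
by lia.
Qed.

End Links.

(** * The degree type *)

Lemma homology_card_diffs (a p m : nat) : 2 <= a -> 1 <= m <= p ->
  rev [seq ((homology_card a p m q.-1)%:Z - (homology_card a p m q)%:Z)%R | q <- iota 1 p]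
  = nseq (p - m) (1 : int)%R ++ (a%:Z)%R :: nseq m.-1 (1 : int)%R.
Proof.
move=> ha /andP[m0 mp]; apply: (@eq_from_nth _ 0%R) => [|k].
  by rewrite size_rev size_map size_iota size_cat /= !size_nseq; lia.
rewrite size_rev size_map size_iota => kp.
rewrite nth_rev ?size_map ?size_iota // (nth_map 0) ?size_iota; last by lia.
rewrite nth_iota; last by lia.
(* Entry k of the reversed list is the difference at q = p - k, so the jump at q = m stands at k = p
   - m. *)
rewrite nth_cat size_nseq nth_nseq /homology_card; case: ltngtP => km; last 1 first.
- by rewrite km subnn /=; case: ifP; case: ifP; lia.
- by case: ifP; case: ifP; lia.
have -> : k - (p - m) = (k - (p - m)).-1.+1 by lia.
by rewrite /= nth_nseq; do 3![case: ifP]; lia.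
Qed.

Local Open Scope ring_scope.

Theorem theorem4p21 (K : fieldType) (a p m : nat)
    (ha : (2 <= a)%N) (hp : (1 <= p)%N) (hm : (1 <= m <= p)%N) :
  PR K (partition_complex a p m) /\
  degree_type K (partition_complex a p m)
    (nseq (p - m) (1 : int) ++ (a%:Z :: nseq m.-1 (1 : int))).
Proof.
(* The degree i fixes n, hence the size of the face; this gives both PR and the values of [sz]. *)
have card_eq n i s : (i + 1 = n%:Z)%R -> s \in partition_complex a p m ->
    rhomology K (link (partition_complex a p m) s) i != 0%VS ->
    (n <= p)%N /\ #|s| = homology_card a p m n.
  move=> hi sP /(link_rhomology_card ha hm sP)[n']; rewrite hi => -[<-].
  by case/andP=> np /eqP.
split.
  split; first split.
  - have [s sP _] := has_link_homology_card K ha hm (leq0n p).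
    exact: partition_complex_closed (sub0set s) sP.
  - by move=> s t ts; apply: partition_complex_closed.
  move=> i s t sP tP sn tn.
  have [n hi _] := link_rhomology_card ha hm sP sn.
  by rewrite (card_eq n i s hi sP sn).2 (card_eq n i t hi tP tn).2.
exists p, (homology_card a p m); split; last by rewrite homology_card_diffs.
  split; first exact: has_link_homology_card.
  by move=> q [s sP sn]; have [] := card_eq q _ s (subrK _ _) sP sn.
move=> q qp; split; first exact: has_link_homology_card.
by move=> s sP sn; have [] := card_eq q _ s (subrK _ _) sP sn.
Qed.
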